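(* The smallest elated number of height $16$ is \[\varepsilon_{16}=9189\times 10^{n_{16}}-1,\] where \[n_{16}=\frac{\varepsilon_{15}/9-9^2-129}{9^2}\] and $\varepsilon_{15}$ is the smallest elated number of height $15$.
   Context: All digits are base $10$. For $a\in\mathbb{Z}^+$ with decimal expansion $a=\sum_{i=0}^n a_i10^i$, $0\le a_i\le 9$, leading digit $a_n\ne 0$, let $E_2(a)=a_n\sum_{i=0}^n a_i^2$. A positive integer $a$ is elated if $E_2^m(a)=1$ for some $m\ge 0$ (iteration), and its height is the smallest such $m$. $\varepsilon_k$ denotes the smallest elated number of height $k$. *)

(* Defs.v *)
From mathcomp Require Import all_boot all_order all_algebra.

Set Implicit Arguments.
Unset Strict Implicit.
Unset Printing Implicit Defensive.

Definition digit (a i : nat) : nat := (a %/ 10 ^ i) %% 10.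

(* For a > 0 the decimal expansion of a has leading index trunc_log 10 a, the
   largest n such that 10 ^ n <= a. *)
Definition E2 (a : nat) : nat :=
  let n := trunc_log 10 a in digit a n * \sum_(i < n.+1) digit a i ^ 2.

(* a is elated and its height is k. *)
Definition elated_of_height (k a : nat) : bool :=
  [&& 0 < a, iter k E2 a == 1 & [forall j : 'I_k, iter j E2 a != 1]].

(* E2 (repunit n) = n for n > 0, so there are elated numbers of every height. *)
Fixpoint repunit (n : nat) : nat :=
  if n is m.+1 then repunit m * 10 + 1 else 0.

Lemma digit_repunit n i : digit (repunit n) i = (i < n).
Proof.
elim: n i => [|n IHn] i; first by rewrite /digit div0n.
case: i => [|i]; first by rewrite /digit expn0 divn1 /= modnMDl.
by rewrite /digit expnS divnMA /= divnMDl // addn0; apply: IHn.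
Qed.

Lemma repunit_bounds n : 10 ^ n <= repunit n.+1 < 10 ^ n.+1.
Proof.
elim: n => [//|n /andP[lo hi]].
rewrite -[repunit n.+2]/(repunit n.+1 * 10 + 1) addn1.
rewrite (expnSr 10 n.+1) {1}expnSr.
move: (repunit _) lo hi => r lo hi; apply/andP; split.
  by apply: leqW; rewrite leq_mul2r lo orbT.
apply: (@leq_trans (r.+1 * 10)); last by rewrite leq_mul2r hi orbT.
by rewrite mulSn -[X in X <= _]add2n leq_add2r.
Qed.

Lemma E2_repunit n : 0 < n -> E2 (repunit n) = n.
Proof.
case: n => // n _; rewrite /E2 (trunc_log_eq _ (repunit_bounds n)) //.
rewrite digit_repunit ltnSn mul1n -[RHS]card_ord -sum1_card.
by apply: eq_bigr => i _; rewrite digit_repunit ltn_ord.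
Qed.

Lemma elated_of_heightS k a :
  0 < a -> a != 1 -> elated_of_height k (E2 a) -> elated_of_height k.+1 a.
Proof.
move=> a_gt0 a_neq1 /and3P[_ Ek /forallP Ej]; apply/and3P; split=> //.
  by rewrite iterSr.
apply/forallP=> -[[|j] lt_j] //; rewrite iterSr.
exact: (Ej (Ordinal (lt_j : j < k))).
Qed.

Lemma exists_elated_of_height k : exists a, elated_of_height k a.
Proof.
case: k => [|k].
  by exists 1; apply/and3P; split=> //; apply/forallP=> -[].
elim: k => [|k [a ha]].
  exists 10; apply: elated_of_heightS => //.
  have -> : E2 10 = 1.
    by rewrite /E2 (@trunc_log_eq 10 1) // !big_ord_recl big_ord0.
  by apply/and3P; split=> //; apply/forallP=> -[].
have /and3P[a_gt0 _ /forallP/(_ ord0) a_neq1] := ha.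
exists (repunit a); apply: elated_of_heightS; last by rewrite E2_repunit.
  by case: a a_gt0 {ha a_neq1} => // a _; rewrite /= addn1.
case: a a_gt0 a_neq1 {ha} => [//|[//|a]] _ _.
by rewrite /= !addn1 eqSS muln_eq0.
Qed.

Definition epsilon (k : nat) : nat := ex_minn (exists_elated_of_height k).

(* Main.v *)
Require Import Defs.
From mathcomp Require Import all_boot all_order all_algebra zify ring.

(** Write a positive number as [a = d * 10 ^ n + q] with leading digit [d] and
    [q < 10 ^ n], and let the deficit of [q] be the sum of [81 - e ^ 2] over its
    [n] digits [e].  Then [E2 a = d * (d ^ 2 + 81 * n - deficit n q)]
    ([E2_leading]).  If [a] is small among the numbers of height [k + 1], then
    [E2 a] must reach the size of a number of height [k] with few digits, so [a]
    consists mostly of nines and its deficit is a small number.  Small deficits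
    are sparse: they are sums of 17, 32, 45, 56, 65, 72, 77, 80 and 81.  This
    makes it possible to describe all numbers of height [k] below
    [2 * 10 ^ n.+1], for a suitable [n], by a shape ([elated_shape]): leading
    digit [l], exactly [n] further digits, total deficit [D].  The shapes are

      height 12: l = 8, D = 51,    height 13: l = 8, D = 168,
      height 14: l = 8, D = 105,   height 15: l = 7, D = 99,
      height 16: l = 9, D = 114.

    The step from one height to the next is [elated_shapeS].  If [a] has height
    [k + 1] and leading digit [d], then [E2 a] has the shape of height [k] and is
    a multiple of [d].  Let [l] and [D] belong to height [k + 1].  A digit
    [d < l] makes [E2 a] too small.  A digit [d > l]
    is excluded by divisibility: the deficit and the residue modulo 9 of a
    string of digits are read off from the same few digits different from 9, and
    no number of the shapes of heights 12, 13, 14 is a multiple of 9; one of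
    height 14 is not a multiple of 8 either, because its last three digits would
    use up an impossible part of the deficit.  For [d = l] the value [E2 a] lies
    below a bound under which the shape contains a single multiple [b] of [l],
    whence [E2 a = b].  This fixes [81 * n - deficit n q], and the length [n]
    itself, since neither [D - 81] nor [D - 162] is a possible deficit.

    Height 12 is the start ([elated_shape12]).  It needs the heights of the
    numbers up to 7290 only, because a number with at most ten digits is
    mapped there; these heights are computed.

    The least number of a shape has its digits after the leading one in
    ascending order, so it ends in nines ([shaped_least]); for heights 15 and 16
    this gives 7488999... and 9188999...  Equating [E2] of the second number with
    the first one, [9 * (81 * n + 210) = epsilon 15], is the asserted formula.

    The lengths of the numbers are solutions of linear equations with right hand
    sides of the form [c * 10 ^ x + c'], where [x] is the length found one height
    below.  They exist because [10] has order [3 ^ i] modulo [3 ^ (i + 2)] and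
    order 6 modulo 7, so that residues modulo powers of 3, and a parity, can be
    passed along the chain ([lengths]). *)

Set Implicit Arguments.
Unset Strict Implicit.
Unset Printing Implicit Defensive.

(** * Deficits of strings of digits *)

Fixpoint deficit (n q : nat) : nat :=
  if n is m.+1 then deficit m (q %/ 10) + (81 - (q %% 10) ^ 2) else 0.

Lemma deficit_sum n q : deficit n q + \sum_(i < n) digit q i ^ 2 = 81 * n.
Proof.
elim: n q => [|n IHn] q; first by rewrite big_ord0.
have tail : \sum_(i < n) digit q (lift ord0 i) ^ 2
          = \sum_(i < n) digit (q %/ 10) i ^ 2.
  by apply: eq_bigr => i _; rewrite /digit -divnMA -expnS.
rewrite big_ord_recl tail /= {1}/digit expn0 divn1.
have := IHn (q %/ 10).
have : (q %% 10) ^ 2 <= 81 by rewrite (@leq_sqr _ 9) -ltnS ltn_pmod.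
set S := \sum_(i < n) _; move: (q %% 10) => r. lia.
Qed.

Lemma deficit_cat m k p q :
  q < 10 ^ k -> deficit (m + k) (p * 10 ^ k + q) = deficit m p + deficit k q.
Proof.
elim: k q => [|k IHk] q; rewrite ?expnS => q_lt.
  have -> : q = 0 by lia.
  by rewrite expn0 muln1 !addn0.
rewrite addnS /=.
have -> : (p * (10 * 10 ^ k) + q) %/ 10 = p * 10 ^ k + q %/ 10 by lia.
have -> : (p * (10 * 10 ^ k) + q) %% 10 = q %% 10 by lia.
by rewrite IHk; lia.
Qed.

Lemma deficit_zeros n : deficit n 0 = 81 * n.
Proof. by elim: n => [|n IHn] //=; rewrite div0n IHn mod0n; lia. Qed.

Lemma deficit_nines n : deficit n (10 ^ n - 1) = 0.
Proof.
elim: n => [|n IHn] //=; rewrite expnS.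
have ? : 0 < 10 ^ n by rewrite expn_gt0.
have -> : (10 * 10 ^ n - 1) %/ 10 = 10 ^ n - 1 by lia.
have -> : (10 * 10 ^ n - 1) %% 10 = 9 by lia.
by rewrite IHn.
Qed.

Lemma deficit_eq0 n q : q < 10 ^ n -> deficit n q = 0 -> q = 10 ^ n - 1.
Proof.
elim: n q => [|n IHn] q /=; rewrite ?expnS => q_lt; first by lia.
move/eqP; rewrite addn_eq0 => /andP[/eqP/IHn hq last9].
have r_le : q %% 10 <= 9 by rewrite -ltnS ltn_pmod.
have r9 : 9 <= q %% 10 by rewrite -(@leq_sqr 9); lia.
by lia.
Qed.

(** Leading zeros are expensive, so a string of small deficit is not a small
    number. *)
Lemma deficit_small n c q :
  c <= n -> q < 10 ^ c -> 81 * (n - c) <= deficit n q.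
Proof.
move=> le_cn q_lt.
have := @deficit_cat (n - c) c 0 q q_lt.
by rewrite mul0n add0n subnK // deficit_zeros => ->; rewrite leq_addr.
Qed.

Lemma leading_digit a : 0 < a ->
  exists n d q, [/\ 0 < d < 10, q < 10 ^ n & a = d * 10 ^ n + q].
Proof.
move=> a_gt0; exists (trunc_log 10 a), (a %/ 10 ^ trunc_log 10 a).
exists (a %% 10 ^ trunc_log 10 a).
have /andP[lo hi] := trunc_log_bounds (isT : 1 < 10) a_gt0.
split; last by rewrite -divn_eq.
  by rewrite divn_gt0 ?expn_gt0 // lo ltn_divLR ?expn_gt0 // -expnS.
by rewrite ltn_pmod ?expn_gt0.
Qed.

Lemma E2_leading d n q : 0 < d < 10 -> q < 10 ^ n ->
  E2 (d * 10 ^ n + q) + d * deficit n q = d * (d ^ 2 + 81 * n).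
Proof.
move=> /andP[d_gt0 d_lt] q_lt; have X_gt0 : 0 < 10 ^ n by rewrite expn_gt0.
have -> : E2 (d * 10 ^ n + q)
        = digit (d * 10 ^ n + q) n *
            \sum_(i < n.+1) digit (d * 10 ^ n + q) i ^ 2.
  by rewrite /E2 (@trunc_log_eq 10 n) // expnS; nia.
have lead : digit (d * 10 ^ n + q) n = d.
  by rewrite /digit divnMDl // divn_small // addn0 modn_small.
have tail i : i < n -> digit (d * 10 ^ n + q) i = digit q i.
  move=> lt_in; rewrite /digit -{1}(subnK lt_in) addnS -addSn expnD expnS mulnA.
  by rewrite divnMDl ?expn_gt0 // mulnCA -modnDml modnMr.
rewrite big_ord_recr /= lead.
under eq_bigr => i _ do rewrite tail //.
rewrite -(deficit_sum n q) -mulnDr; congr (_ * _).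
by rewrite [X in X + _]addnC -addnA [X in _ + X]addnC.
Qed.

Lemma E2_gt0 a : 0 < a -> 0 < E2 a.
Proof.
move=> /leading_digit[n [d [q [d_bd q_lt ->]]]].
have := E2_leading d_bd q_lt; have := deficit_sum n q.
set S := \sum_(i < n) _; move: (deficit n q) (E2 _) => D e hD.
by case/andP: d_bd => d_gt0 _; rewrite -hD; nia.
Qed.

(** * Attainable small deficits *)

(** Pairs consist of a deficit and of a residue modulo 9.  Appending the digit 9
    changes neither component, which is why finitely many pairs suffice for
    strings of all lengths. *)
Definition closed_under_digits (B : nat) (s : seq (nat * nat)) : bool :=
  ((0, 0) \in s) &&
  all (fun x => all (fun e => let y := (x.1 + (81 - e ^ 2), (x.2 + e) %% 9) in
         if y.1 <= B then y \in s else true) (iota 0 10)) s.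

Lemma deficit_in_closed B s n q : closed_under_digits B s ->
  q < 10 ^ n -> deficit n q <= B -> (deficit n q, q %% 9) \in s.
Proof.
case/andP=> s0 sS; elim: n q => [|n IHn] q; rewrite ?expnS => q_lt.
  by have -> : q = 0 by lia.
rewrite [deficit n.+1 q]/= => leB.
have q'_in : (deficit n (q %/ 10), (q %/ 10) %% 9) \in s by apply: IHn; lia.
have := allP (allP sS _ q'_in) (q %% 10).
rewrite mem_iota ltn_pmod //= leB.
have -> : ((q %/ 10) %% 9 + q %% 10) %% 9 = q %% 9 by lia.
by apply.
Qed.

(** Each pass over [e] adds up to ten copies of the digit [e]; more copies of a
    digit other than 9 exceed 170, as [81 - 8 ^ 2 = 17].  The bound 170 covers
    the deficits 168, 105, 99, 114 and 51 of the five shapes. *)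
Definition spectrum : seq (nat * nat) :=
  foldr (fun e s => [seq x <- [seq (x.1 + k * (81 - e ^ 2), (x.2 + k * e) %% 9)
                              | x <- s, k <- iota 0 11] | x.1 <= 170])
    [:: (0, 0)] (iota 0 9).

Lemma spectrum_closed : closed_under_digits 170 spectrum.
Proof. by vm_cast_no_check isT. Qed.

Definition attainable (x : nat) : bool := has (fun y => y.1 == x) spectrum.

Lemma deficit_attainable n q :
  q < 10 ^ n -> deficit n q <= 170 -> attainable (deficit n q).
Proof.
move=> q_lt le170; apply/hasP; exists (deficit n q, q %% 9); last exact: eqxx.
exact: deficit_in_closed spectrum_closed q_lt le170.
Qed.

(** Once digits of deficit [e] have been fixed, the others have to make up the
    rest of the total deficit [D].  The conditional, rather than a conjunction,
    keeps call-by-value evaluation from searching the spectrum when [e > D]. *)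
Definition completable (D e : nat) : bool :=
  if e <= D then attainable (D - e) else false.

Lemma deficit_completable n q D e : q < 10 ^ n -> D <= 170 ->
  e + deficit n q = D -> completable D e.
Proof.
move=> q_lt D_le eD; rewrite /completable -eD leq_addr addKn.
by apply: deficit_attainable => //; apply: leq_trans D_le; rewrite -eD leq_addl.
Qed.

(** * Shapes *)

Lemma elated_of_height_pred k a :
  elated_of_height k.+1 a -> elated_of_height k (E2 a).
Proof.
case/and3P=> a_gt0 Ek /forallP Ej; apply/and3P; split; first exact: E2_gt0.
  by rewrite -iterSr.
apply/forallP=> j; rewrite -iterSr.
exact: (Ej (lift ord0 j)).
Qed.

Lemma elated_of_height_gt0 k a : elated_of_height k a -> 0 < a.
Proof. by case/and3P. Qed.

Definition shaped (l n D a : nat) : Prop :=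
  exists2 q, q < 10 ^ n & a = l * 10 ^ n + q /\ deficit n q = D.

(** The bound [2 * 10 ^ n.+1] includes the numbers with one digit more than the
    shape allows, provided that they start with 1: values of [E2] at the next
    height can exceed [10 ^ n.+1], but not by a factor of 2. *)
Definition elated_shape (k l n D : nat) : Prop :=
  forall a, elated_of_height k a -> a < 2 * 10 ^ n.+1 -> shaped l n D a.

Lemma shaped_E2 l n D a : 0 < l < 10 -> shaped l n D a ->
  E2 a + l * D = l * (l ^ 2 + 81 * n).
Proof. by move=> l_bd [q q_lt [-> <-]]; apply: E2_leading. Qed.

Lemma leading_digit_lt a n : 0 < a -> a < 2 * 10 ^ n.+1 ->
  exists j d q, [/\ 0 < d < 10, q < 10 ^ j, a = d * 10 ^ j + q
    & j <= n \/ j = n.+1 /\ d = 1].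
Proof.
move=> /leading_digit[j [d [q [d_bd q_lt ->]]]] a_lt.
exists j, d, q; split=> //; have [le_jn|lt_nj] := leqP j n; [by left | right].
have X_gt0 : 0 < 10 ^ n.+1 by rewrite expn_gt0.
move: lt_nj; rewrite leq_eqVlt => /predU1P[ej|lt_nj].
  by split=> //; move: a_lt; rewrite -ej; case/andP: d_bd; nia.
have le10 : 10 ^ n.+2 <= 10 ^ j by rewrite leq_exp2l.
by move: le10 a_lt; rewrite expnS; case/andP: d_bd; nia.
Qed.

(** The step from height [k] to height [k + 1].  The value [E2 a] has the shape of
    height [k] and is a multiple of the leading digit [d] of [a]: [small] rules
    out [d < l'], [no_larger] rules out [d > l'], and for [d = l'] the value is
    [b] by [uniq_b].  A number that is shorter by [i] digits would have deficit
    [D' - 81 * i]; as [D' <= 170], only [i = 1] and [i = 2] have to be excluded. *)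
Lemma elated_shapeS k l n D l' n' D' b :
    elated_shape k l n D -> 0 < l -> 7 <= l' <= 9 -> D' <= 170 ->
    b + l' * D' = l' * (l' ^ 2 + 81 * n') ->
    ~~ completable D' 81 -> ~~ completable D' (81 * 2) ->
    (l' - 1) * ((l' - 1) ^ 2 + 81 * n') < l * 10 ^ n ->
    729 * n'.+1 < 2 * 10 ^ n.+1 ->
    (forall t d, shaped l n D t -> l' < d < 10 -> ~~ (d %| t)) ->
    (forall t, shaped l n D t -> l' %| t -> t <= b + l' * D' -> t = b) ->
  elated_shape k.+1 l' n' D'.
Proof.
move=> Hk l_gt0 l'_bd D'_le b_def gap1 gap2 small big no_larger uniq_b a Ha a_lt.
have [j [d [q [d_bd q_lt a_def j_le]]]] :=
  leading_digit_lt (elated_of_height_gt0 Ha) a_lt.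
have E2a := E2_leading d_bd q_lt; rewrite -a_def in E2a.
have D_le : deficit j q <= 81 * j by rewrite -(deficit_sum j q) leq_addr.
have t_dvd : d %| E2 a.
  by rewrite -(addnK (d * deficit j q) (E2 a)) E2a -mulnBr dvdn_mulr.
have t_le : E2 a <= d * (d ^ 2 + 81 * j) by rewrite -E2a leq_addr.
have t_lt : E2 a < 2 * 10 ^ n.+1.
  apply: leq_ltn_trans t_le (leq_ltn_trans _ big).
  case: j_le => [le_jn|[-> ->]]; last by lia.
  apply: (@leq_trans (9 * (9 ^ 2 + 81 * n'))); last by lia.
  case/andP: d_bd => _ d_lt; apply: leq_mul => //.
  by rewrite leq_add ?leq_sqr ?leq_mul.
have t_shape : shaped l n D (E2 a).
  exact: Hk (elated_of_height_pred Ha) t_lt.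
have t_ge : l * 10 ^ n <= E2 a by case: t_shape => r _ [-> _]; rewrite leq_addr.
have [lt_dl'|lt_l'd|ed] := ltngtP d l'.
- suff : E2 a < l * 10 ^ n by rewrite ltnNge t_ge.
  apply: leq_ltn_trans t_le (leq_ltn_trans _ small).
  have ? : 6 <= l' - 1 by lia.
  have ? : d <= l' - 1 by lia.
  case: j_le => [le_jn|[-> ->]].
    by rewrite leq_mul ?leq_add ?leq_sqr ?leq_mul.
  (* One digit more than [n'] forces the leading digit 1; the missing factor
     [l' - 1 >= 6] makes up for the additional digit. *)
  apply: (@leq_trans (6 * (6 ^ 2 + 81 * n'))); first by lia.
  by rewrite leq_mul ?leq_add ?leq_sqr ?leq_mul.
- have /negP[] : ~~ (d %| E2 a) by apply: (no_larger _ _ t_shape); lia.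
  exact: t_dvd.
have le_jn' : j <= n' by case: j_le => // -[_ d1]; lia.
have t_b : E2 a = b.
  apply: uniq_b t_shape _ _; first by rewrite -ed.
  rewrite b_def; apply: leq_trans t_le _; rewrite ed.
  by rewrite leq_mul ?leq_add ?leq_mul.
rewrite t_b ed in E2a.
have eD : deficit j q + 81 * (n' - j) = D'.
  have l'_gt0 : 0 < l' by lia.
  apply/eqP; rewrite -(eqn_pmul2l l'_gt0) -(eqn_add2l b) b_def mulnDr addnA E2a.
  by rewrite -mulnDr eqn_pmul2l //; apply/eqP; lia.
have [ej|gap] := posnP (n' - j).
  have e_j : j = n' by lia.
  by exists q; rewrite -?e_j // a_def ed -eD ej; split=> //; lia.
have comp : completable D' (81 * (n' - j)).
  by apply: deficit_completable q_lt D'_le _; rewrite addnC.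
have [e1|e2] : n' - j = 1 \/ n' - j = 2 by lia.
  by rewrite e1 (negPf gap1) in comp.
by rewrite e2 (negPf gap2) in comp.
Qed.

Lemma shaped_split l m k D t : shaped l (m + k) D t ->
  exists p s, [/\ p < 10 ^ m, s < 10 ^ k, t = (l * 10 ^ m + p) * 10 ^ k + s
    & deficit m p + deficit k s = D].
Proof.
case=> q q_lt [-> <-]; have X_gt0 : 0 < 10 ^ k by rewrite expn_gt0.
have s_lt : q %% 10 ^ k < 10 ^ k by rewrite ltn_pmod.
exists (q %/ 10 ^ k), (q %% 10 ^ k); split=> //.
- by rewrite ltn_divLR // -expnD.
- by rewrite mulnDl -mulnA -expnD -addnA -divn_eq.
- by rewrite {3}(divn_eq q (10 ^ k)) deficit_cat.
Qed.

Lemma shaped_cat l m k p s : p < 10 ^ m -> s < 10 ^ k ->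
  shaped l (m + k) (deficit m p + deficit k s) ((l * 10 ^ m + p) * 10 ^ k + s).
Proof.
move=> p_lt s_lt; exists (p * 10 ^ k + s); last first.
  by rewrite deficit_cat // expnD mulnDl mulnA addnA.
rewrite expnD; nia.
Qed.

Lemma elated_of_shaped k l n D b a : 0 < l < 10 -> shaped l n D a -> a != 1 ->
    b + l * D = l * (l ^ 2 + 81 * n) -> elated_of_height k b ->
  elated_of_height k.+1 a.
Proof.
move=> l_bd a_shape a_neq1 b_def Hb.
have a_gt0 : 0 < a.
  case: a_shape => q _ [-> _]; apply: leq_trans (leq_addr _ _).
  by case/andP: l_bd => l_gt0 _; rewrite muln_gt0 l_gt0 expn_gt0.
apply: elated_of_heightS => //.
have := shaped_E2 l_bd a_shape; rewrite -b_def => /eqP.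
by rewrite eqn_add2r => /eqP->.
Qed.

(** * Least numbers of a shape, and divisibility by 8 and 9 *)

(** The three digits [p] after the leading one decide the comparison: for
    [p < c] the rest of the deficit is not attainable, and for [p = c] nothing is
    left of it, so that [m] nines follow, whence the [c.+1] and the [- 1] in [b].
    Numbers slightly above [b] contain many zeros, each of which costs 81; this
    yields the gap of [10 ^ 4]. *)
Lemma shaped_least l m c D t : 7 <= m -> D <= 170 -> c.+1 < 1000 ->
    deficit 3 c = D ->
    all (fun p => ~~ completable D (deficit 3 p)) (iota 0 c) ->
    shaped l (3 + m) D t ->
  let b := (1000 * l + c.+1) * 10 ^ m - 1 in b <= t /\ (t < b + 10 ^ 4 -> t = b).
Proof.
move=> m_ge D_le c_lt cD minc /shaped_split[p [s [p_lt s_lt t_def pD]]] b.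
have X_ge : 10 ^ 4 <= 10 ^ m by rewrite leq_exp2l //; lia.
have bE : b = (1000 * l + c) * 10 ^ m + (10 ^ m - 1) by rewrite /b; nia.
have [lt_pc|lt_cp|ep] := ltngtP p c.
- have /negP[] := allP minc p ltac:(by rewrite mem_iota).
  exact: deficit_completable s_lt D_le pD.
- have [ep|lt_c1p] := eqVneq p c.+1; last first.
    have : b + 10 ^ 4 <= t by rewrite bE t_def; nia.
    by split; lia.
  have [s_ge|s_small] := leqP (10 ^ 4) s.
    have : b + 10 ^ 4 <= t by rewrite bE t_def ep; nia.
    by split; lia.
  have := deficit_small (ltac:(lia) : 4 <= m) s_small; lia.
- have -> : t = b; last by split.
  have s_max : s = 10 ^ m - 1.
    by apply: deficit_eq0 => //; move: pD; rewrite ep cD; lia.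
  by rewrite t_def ep bE s_max; lia.
Qed.

Lemma shaped_witness l m c :
  c < 1000 ->
  shaped l (3 + m) (deficit 3 c) ((1000 * l + c.+1) * 10 ^ m - 1).
Proof.
move=> c_lt; have X_gt0 : 0 < 10 ^ m by rewrite expn_gt0.
have -> : (1000 * l + c.+1) * 10 ^ m - 1
        = (l * 10 ^ 3 + c) * 10 ^ m + (10 ^ m - 1) by nia.
have := @shaped_cat l 3 m c (10 ^ m - 1) c_lt ltac:(lia).
by rewrite deficit_nines addn0.
Qed.

Lemma shaped_dvd9 l n D t : D <= 170 -> shaped l n D t -> 9 %| t ->
  has (fun x => (x.1 == D) && (9 %| l + x.2)) spectrum.
Proof.
move=> D_le [q q_lt [-> qD]] t9; apply/hasP.
exists (D, q %% 9); first by rewrite -qD (deficit_in_closed spectrum_closed) ?qD.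
rewrite eqxx /=; apply: etrans t9; rewrite /dvdn modnDmr -[in RHS]modnDml.
by rewrite -modnMmr -modnXm exp1n muln1 modnDml.
Qed.

(** Divisibility by 8 depends on the last three digits only. *)
Lemma shaped_dvd8 l m D t : shaped l (m + 3) D t -> 8 %| t ->
  exists p s, [/\ p < 10 ^ m, s < 1000, 8 %| s,
    t = (l * 10 ^ m + p) * 1000 + s & deficit m p + deficit 3 s = D].
Proof.
case/shaped_split=> [p [s [p_lt s_lt -> pD]]] t8; exists p, s; split=> //.
by move: t8; rewrite dvdn_addr // dvdn_mull.
Qed.

(** * Heights of small numbers *)

(** A form of [E2] for numbers with at most [n] digits that evaluates by
    recursion, without the opaque big operator. *)
Fixpoint E2_below (n a : nat) : nat :=
  if n is m.+1 then
    if a < 10 ^ m then E2_below m a else (a %/ 10 ^ m) * (81 * n - deficit n a)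
  else 0.

Lemma E2_belowE n a : 0 < a < 10 ^ n -> E2_below n a = E2 a.
Proof.
elim: n => [|n IHn] /andP[a_gt0 a_lt]; first by rewrite expn0 in a_lt; lia.
rewrite [E2_below _ _]/=; have [lt_aX|le_Xa] := ltnP; first by rewrite IHn ?a_gt0.
have X_gt0 : 0 < 10 ^ n by rewrite expn_gt0.
have r_lt : a %% 10 ^ n < 10 ^ n by rewrite ltn_pmod.
have d_bd : 0 < a %/ 10 ^ n < 10.
  by rewrite divn_gt0 // le_Xa ltn_divLR // -expnS.
rewrite -[deficit _ _ + _]/(deficit n.+1 a) (divn_eq a (10 ^ n)).
set d := a %/ 10 ^ n in d_bd *; set r := a %% 10 ^ n in r_lt *.
rewrite divnMDl // (divn_small r_lt) addn0.
rewrite -[n.+1]add1n deficit_cat //= (modn_small (proj2 (andP d_bd))).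
have := E2_leading d_bd r_lt; have := deficit_sum n r.
have : d ^ 2 <= 81 by rewrite (@leq_sqr _ 9); lia.
set S := \sum_(i < n) _; move: (E2 _) (deficit n r) (d ^ 2) => e D d2 d2_le SD.
have -> : 81 * n.+1 - (81 - d2 + D) = d2 + S by lia.
by rewrite -SD addnA !mulnDr => /eqP; rewrite addnAC eqn_add2r => /eqP ->.
Qed.

Lemma E2_four_digits l x y z : 0 < l < 10 -> x < 10 -> y < 10 -> z < 10 ->
  E2 (1000 * l + 100 * x + 10 * y + z) = l * (l ^ 2 + x ^ 2 + y ^ 2 + z ^ 2).
Proof.
move=> l_bd x_lt y_lt z_lt; set q := 100 * x + 10 * y + z.
have -> : 1000 * l + 100 * x + 10 * y + z = l * 10 ^ 3 + q by rewrite /q; lia.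
have q_lt : q < 10 ^ 3 by rewrite /q; lia.
have D_le : deficit 3 q = (81 - x ^ 2) + (81 - y ^ 2) + (81 - z ^ 2).
  rewrite /=; have -> : q %% 10 = z by rewrite /q; lia.
  have -> : q %/ 10 %% 10 = y by rewrite /q; lia.
  by have -> : q %/ 10 %/ 10 %% 10 = x by rewrite /q; lia.
have := E2_leading l_bd q_lt; rewrite D_le.
have : x ^ 2 <= 81 by rewrite (@leq_sqr _ 9).
have : y ^ 2 <= 81 by rewrite (@leq_sqr _ 9).
have : z ^ 2 <= 81 by rewrite (@leq_sqr _ 9).
move: (E2 _) (x ^ 2) (y ^ 2) (z ^ 2) (l ^ 2) => e x2 y2 z2 l2 hz hy hx /eqP.
have -> : l2 + 81 * 3 = (l2 + x2 + y2 + z2) + ((81 - x2) + (81 - y2) + (81 - z2)).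
  by lia.
by rewrite [X in _ == X]mulnDr eqn_add2r => /eqP.
Qed.

(** The extreme value is [E2 9999 = 9 * (4 * 81)], one less than 2917. *)
Lemma E2_lt2917 a : 0 < a < 10 ^ 4 -> 0 < E2 a < 2917.
Proof.
move=> /andP[a_gt0 a_lt]; rewrite E2_gt0 //=.
have [j [d [q [d_bd q_lt a_def]]]] := leading_digit a_gt0.
have j_lt : j < 4.
  by rewrite -(@ltn_exp2l 10) //; apply: leq_ltn_trans a_lt; rewrite a_def; nia.
have E2a := E2_leading d_bd q_lt; rewrite -a_def in E2a.
apply: (@leq_ltn_trans (d * (d ^ 2 + 81 * j))); first by rewrite -E2a leq_addr.
apply: (@leq_ltn_trans (9 * (9 ^ 2 + 81 * 3))); last by [].
by rewrite leq_mul ?leq_add ?leq_sqr ?leq_mul; lia.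
Qed.

Definition E2_table (B : nat) : seq nat := map (E2_below 4) (iota 0 B).

Definition height_step (T : seq nat) (s : seq bool) : seq bool :=
  [seq (x.1 != 1) && nth false s x.2 | x <- zip (iota 0 (size T)) T].

(** Entry [a] of the table tells whether [a] has height [k].  The tables of
    successive heights share one table of values of [E2]. *)
Definition height_table (B k : nat) : seq bool :=
  let T := E2_table B in iter k (height_step T) [seq a == 1 | a <- iota 0 B].

Lemma height_tableE B k a : B <= 10 ^ 4 ->
    (forall b, 0 < b < B -> E2 b < B) -> 0 < a < B ->
  nth false (height_table B k) a = elated_of_height k a.
Proof.
move=> B_le E2B; have sz : size (zip (iota 0 B) (E2_table B)) = B.
  by rewrite size_zip size_map size_iota minnn.
elim: k a => [|k IHk] a a_bd; have /andP[a_gt0 a_lt] := a_bd.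
  rewrite (nth_map 0) ?size_iota // nth_iota // add0n.
  rewrite /elated_of_height a_gt0 /=.
  by apply/esym/andb_idr => _; apply/forallP => -[].
have -> : nth false (height_table B k.+1) a
        = (a != 1) && nth false (height_table B k) (E2_below 4 a).
  rewrite /height_table iterS {1}/height_step size_map size_iota.
  rewrite (nth_map (0, 0)) ?sz // nth_zip ?size_map ?size_iota //.
  by rewrite (nth_map 0) ?size_iota // nth_iota.
rewrite E2_belowE ?a_gt0 ?(leq_trans a_lt) //.
rewrite IHk ?E2_gt0 ?E2B //.
apply/idP/idP => [/andP[a_neq1]|Ha]; first exact: elated_of_heightS.
by rewrite elated_of_height_pred // andbT; case/and3P: Ha => _ _ /forallP/(_ ord0).
Qed.

Lemma height11_table : all negb (height_table 2917 11).
Proof. by vm_cast_no_check isT. Qed.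

Lemma height11_ge t : elated_of_height 11 t -> 2917 <= t.
Proof.
move=> Ht; rewrite leqNgt; apply/negP => t_lt.
have t_in : nth false (height_table 2917 11) t.
  rewrite height_tableE ?(elated_of_height_gt0 Ht) // => b b_bd.
  by have /andP[] := @E2_lt2917 b ltac:(lia).
have := all_nthP false height11_table t.
case: (ltnP t (size (height_table 2917 11))) => [_ /(_ isT)|le_st _].
  by rewrite t_in.
by move: t_in; rewrite nth_default.
Qed.

(** All numbers [t] of height 11 with four digits [l], [x], [y], [z] are tested
    as values of [E2] at a number with leading digit [d] and [j] further digits.
    For [2 <= l <= 7] there are six such [t], the permutations of 5369 that start
    with 5.  For
    [t = 5369], [d = 7] and [j = 9] the deficit would be 11, which is not
    attainable; the only solution is [t = 5936] with [d = 8] and [j = 9]. *)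
Lemma height11_check :
  let s := height_table 2917 10 in
  all (fun l => all (fun x => all (fun y => all (fun z =>
    if nth false s (l * (l ^ 2 + x ^ 2 + y ^ 2 + z ^ 2)) then
      let t := 1000 * l + 100 * x + 10 * y + z in
      all (fun d => all (fun j => let D := d ^ 2 + 81 * j - t %/ d in
        if [&& d %| t, t %/ d <= d ^ 2 + 81 * j & (j <= 9) || (d == 1)] then
          [&& D <= 170 & ~~ attainable D] || [&& d == 8, j == 9 & D == 51]
        else true)
        (iota 0 11)) (iota 1 9)
    else true) (iota 0 10)) (iota 0 10)) (iota 0 10)) (iota 2 6).
Proof. by vm_cast_no_check isT. Qed.

(** A number below [2 * 10 ^ 10] with eleven digits starts with 1, so that
    [E2 a <= 9 * (9 ^ 2 + 81 * 9) = 7290] in all cases, and [height11_check]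
    applies to [E2 a]. *)
Lemma elated_shape12 : elated_shape 12 8 9 51.
Proof.
move=> a Ha a_lt.
have [j [d [q [d_bd q_lt a_def j_le]]]] :=
  leading_digit_lt (elated_of_height_gt0 Ha) a_lt.
have E2a := E2_leading d_bd q_lt; rewrite -a_def in E2a.
have D_le : deficit j q <= 81 * j by rewrite -(deficit_sum j q) leq_addr.
have j_lt : j < 11 by case: j_le => [|[->]]; lia.
have Ht := elated_of_height_pred Ha; have t_ge := height11_ge Ht.
have t_le : E2 a <= 9 * (9 ^ 2 + 81 * 9).
  apply: (@leq_trans (d * (d ^ 2 + 81 * j))); first by rewrite -E2a leq_addr.
  case: j_le => [le_j9|[-> ->]]; last by [].
  by rewrite leq_mul ?leq_add ?leq_sqr ?leq_mul; lia.
have E2a_div : E2 a = d * (d ^ 2 + 81 * j - deficit j q).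
  by rewrite mulnBr -E2a addnK.
move: (E2 a) Ht t_ge t_le E2a_div => t Ht t_ge t_le t_def.
have [l [x [y [z [l_bd x_lt y_lt z_lt t_digits]]]]] : exists l x y z,
    [/\ 2 <= l < 8, x < 10, y < 10, z < 10
      & t = 1000 * l + 100 * x + 10 * y + z].
  exists (t %/ 10 %/ 10 %/ 10), (t %/ 10 %/ 10 %% 10), (t %/ 10 %% 10), (t %% 10).
  by split; lia.
have t_bd : 0 < E2 t < 2917 by apply: E2_lt2917; lia.
have E2t : E2 t = l * (l ^ 2 + x ^ 2 + y ^ 2 + z ^ 2).
  by rewrite t_digits E2_four_digits //; lia.
have in_table :
    nth false (height_table 2917 10) (l * (l ^ 2 + x ^ 2 + y ^ 2 + z ^ 2)).
  rewrite -E2t height_tableE ?(elated_of_height_pred Ht) // => b b_bd.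
  by have /andP[] := @E2_lt2917 b ltac:(lia).
have := height11_check; move: (height_table 2917 10) in_table => s in_table chk.
have l_in : l \in iota 2 6 by rewrite mem_iota.
have := allP (allP (allP (allP chk l l_in) x _) y _) z.
rewrite !mem_iota => /(_ x_lt y_lt z_lt).
rewrite in_table -t_digits => /allP/(_ d).
rewrite mem_iota => /(_ d_bd)/allP/(_ j).
rewrite mem_iota => /(_ j_lt).
have d_gt0 : 0 < d by case/andP: d_bd.
have -> : t %/ d = d ^ 2 + 81 * j - deficit j q by rewrite t_def mulKn.
have d_dvd : d %| t by rewrite t_def dvdn_mulr.
have D_le' : deficit j q <= d ^ 2 + 81 * j by apply: leq_trans (leq_addl _ _).
have j9 : (j <= 9) || (d == 1) by case: j_le => [->|[_ ->]]; rewrite ?orbT.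
rewrite d_dvd leq_subr j9 subKn //.
case/orP=> [/andP[D_small /negP[]]|/and3P[/eqP d8 /eqP ej /eqP D51]].
  exact: deficit_attainable.
by move: a_def q_lt D51; rewrite d8 ej => -> q_lt D51; exists q.
Qed.

Lemma height755 : elated_of_height 10 755.
Proof.
have in_table : nth false (height_table 2917 10) 755 by vm_cast_no_check isT.
have stable b : 0 < b < 2917 -> E2 b < 2917.
  by move=> b_bd; have /andP[] := @E2_lt2917 b ltac:(lia).
by rewrite (@height_tableE 2917 10 755 isT stable isT) in in_table.
Qed.

(** The value of [E2] at 8999999888 and at all other numbers of the shape of
    height 12; [8 * 742] is the factorization by the leading digit. *)
Lemma height5936 : elated_of_height 11 (8 * 742).
Proof.
have -> : 8 * 742 = 1000 * 5 + 100 * 9 + 10 * 3 + 6 by lia.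
apply: elated_of_heightS; [lia | lia |].
rewrite E2_four_digits //; exact: height755.
Qed.

(** * Searches over prefixes and suffixes *)

Lemma end51_check :
  all (fun s =>
    if 8 %| s then completable 51 (deficit 3 s) ==> (s == 888) else true)
    (iota 0 1000).
Proof. by vm_cast_no_check isT. Qed.

(** Here [p] and [s] are the first two and the last three digits after the leading
    8.  Prefixes above 36 are too large for the bound in [shaped168_dvd8]. *)
Lemma ends168_check :
  let ss := [seq s <- iota 0 1000 | (8 %| s) && (deficit 3 s <= 168)] in
  all (fun p => all (fun s => completable 168 (deficit 2 p + deficit 3 s)
                              ==> (p == 36) && (s == 888)) ss) (iota 0 37).
Proof. by vm_cast_no_check isT. Qed.

Lemma end105_check :
  all (fun s => if 8 %| s then ~~ completable 105 (deficit 3 s) else true)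
    (iota 0 1000).
Proof. by vm_cast_no_check isT. Qed.

Lemma mod9_check :
  all (fun D => ~~ has (fun x => (x.1 == D) && (9 %| 8 + x.2)) spectrum)
    [:: 51; 168; 105].
Proof. by vm_cast_no_check isT. Qed.

Lemma gaps_check :
  all (fun D => ~~ completable D 81 && ~~ completable D (81 * 2))
    [:: 168; 105; 99; 114].
Proof. by vm_cast_no_check isT. Qed.

Lemma shaped8_ndvd9 n D t : D \in [:: 51; 168; 105] -> shaped 8 n D t -> ~~ (9 %| t).
Proof.
move=> D_in t_shape; apply/negP => t9; apply/negP: (allP mod9_check D D_in).
rewrite negbK; apply: shaped_dvd9 t_shape t9.
by move: D_in; rewrite !inE => /or3P[]/eqP->.
Qed.

(** The last three digits must be even and even 888, whose deficit is 51
    already. *)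
Lemma shaped51_dvd8 m t :
  shaped 8 (m + 3) 51 t -> 8 %| t -> t = 9 * 10 ^ (m + 3) - 112.
Proof.
move=> /shaped_dvd8 t_split /t_split[p [s [p_lt s_lt s8 t_def pD]]].
have s_in : s \in iota 0 1000 by rewrite mem_iota.
have := allP end51_check s s_in; rewrite s8.
have -> : completable 51 (deficit 3 s).
  by apply: deficit_completable p_lt _ _ => //; rewrite addnC.
move/eqP=> s888; have D888 : deficit 3 888 = 51 by [].
have p_max : p = 10 ^ m - 1.
  by apply: deficit_eq0 => //; move: pD; rewrite s888 D888; lia.
have X_gt0 : 0 < 10 ^ m by rewrite expn_gt0.
by rewrite t_def p_max s888 expnD; lia.
Qed.

Lemma shaped51 m : shaped 8 (m + 3) 51 (9 * 10 ^ (m + 3) - 112).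
Proof.
have X_gt0 : 0 < 10 ^ m by rewrite expn_gt0.
have := @shaped_cat 8 m 3 (10 ^ m - 1) 888 ltac:(lia) ltac:(by []).
by rewrite deficit_nines expnD; congr (shaped _ _ _ _); lia.
Qed.

(** The bound is [E2] of the largest number with leading digit 8 and the length
    of the shape of height 14.  Below it, the multiple of 8 is unique: it is
    836, nines, 888. *)
Lemma shaped168_dvd8 k t : 7 <= k -> shaped 8 (2 + k + 3) 168 t -> 8 %| t ->
  t <= 837 * 10 ^ (k + 3) + 728 -> t = 837 * 10 ^ (k + 3) - 112.
Proof.
move=> k_ge /shaped_dvd8 t_split /t_split[r [s [r_lt s_lt s8 t_def rD]]] t_le.
have r_shape : shaped 8 (2 + k) (deficit (2 + k) r) (8 * 10 ^ (2 + k) + r).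
  by exists r.
have [p [q [p_lt q_lt r_def pD]]] := shaped_split r_shape.
have X_ge : 10 ^ 4 <= 10 ^ k by rewrite leq_exp2l //; lia.
rewrite r_def -pD in t_def rD; rewrite expnD in t_le *.
have [p_le|p_gt] := leqP p 36.
  have p_in : p \in iota 0 37 by rewrite mem_iota.
  have s_in : s \in [seq s <- iota 0 1000 | (8 %| s) && (deficit 3 s <= 168)].
    by rewrite mem_filter s8 mem_iota; lia.
  have := allP (allP ends168_check p p_in) s s_in.
  have -> : completable 168 (deficit 2 p + deficit 3 s).
    by apply: deficit_completable q_lt _ _ => //; rewrite addnAC.
  case/andP=> /eqP p36 /eqP s888.
  have q_max : q = 10 ^ k - 1.
    apply: deficit_eq0 => //; have D36 : deficit 2 36 = 117 by [].
    have D888 : deficit 3 888 = 51 by [].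
    by move: rD; rewrite p36 s888 D36 D888; lia.
  by rewrite t_def p36 s888 q_max; lia.
have p37 : p = 37 by nia.
have q_small : q < 10 ^ 0 by rewrite expn0; lia.
by have := deficit_small (leq0n k) q_small; lia.
Qed.

Lemma shaped168 k : shaped 8 (2 + k + 3) 168 (837 * 10 ^ (k + 3) - 112).
Proof.
have X_gt0 : 0 < 10 ^ k by rewrite expn_gt0.
have := @shaped_cat 8 2 k 36 (10 ^ k - 1) ltac:(by []) ltac:(lia).
case=> r r_lt [r_def rD].
have := @shaped_cat 8 (2 + k) 3 r 888 r_lt ltac:(by []).
by rewrite -r_def rD deficit_nines expnD; congr (shaped _ _ _ _); lia.
Qed.

Lemma shaped105_ndvd8 m t : shaped 8 (m + 3) 105 t -> ~~ (8 %| t).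
Proof.
move=> t_shape; apply/negP => /(shaped_dvd8 t_shape)[p [s [p_lt s_lt s8 _ pD]]].
have s_in : s \in iota 0 1000 by rewrite mem_iota.
have := allP end105_check s s_in; rewrite s8 => /negP[].
by apply: deficit_completable p_lt _ _ => //; rewrite addnC.
Qed.

Lemma shaped105_least m t : 7 <= m -> shaped 8 (3 + m) 105 t ->
  let b := (1000 * 8 + 579) * 10 ^ m - 1 in b <= t /\ (t < b + 10 ^ 4 -> t = b).
Proof.
move=> m_ge; have chk : all (fun p => ~~ completable 105 (deficit 3 p)) (iota 0 578).
  by vm_cast_no_check isT.
exact: (@shaped_least 8 m 578 105 t m_ge isT isT (erefl _) chk).
Qed.

Lemma shaped99_least m t : 7 <= m -> shaped 7 (3 + m) 99 t ->
  let b := (1000 * 7 + 489) * 10 ^ m - 1 in b <= t /\ (t < b + 10 ^ 4 -> t = b).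
Proof.
move=> m_ge; have chk : all (fun p => ~~ completable 99 (deficit 3 p)) (iota 0 488).
  by vm_cast_no_check isT.
exact: (@shaped_least 7 m 488 99 t m_ge isT isT (erefl _) chk).
Qed.

Lemma shaped114_least m t : 7 <= m -> shaped 9 (3 + m) 114 t ->
  let b := (1000 * 9 + 189) * 10 ^ m - 1 in b <= t /\ (t < b + 10 ^ 4 -> t = b).
Proof.
move=> m_ge; have chk : all (fun p => ~~ completable 114 (deficit 3 p)) (iota 0 188).
  by vm_cast_no_check isT.
exact: (@shaped_least 9 m 188 114 t m_ge isT isT (erefl _) chk).
Qed.

(** * The lengths *)

Lemma expn_mod_period b p M u c r : b ^ p %% M = 1 -> b ^ c %% M = r ->
  b ^ (p * u + c) %% M = r.
Proof.
by move=> bp <-; rewrite expnD expnM -modnMml -modnXm bp exp1n modnMml mul1n.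
Qed.

(** The equations say that [E2] maps the number of one height to the number of
    the height below, with [j + 3], [2 + k + 3], [3 + m], [3 + r] and [3 + n]
    digits after the leading one.  The variable [j] stands for 6 so that
    [10 ^ (j + 3)] remains symbolic. *)
Lemma lengths j : j = 6 -> exists k m r n,
  [/\ 7 <= k /\ 648 * (2 + k + 3) = 9 * 10 ^ (j + 3) + 720,
      24 * (3 + m) = 31 * 10 ^ (k + 3) + 8,
      567 * (3 + r) = (1000 * 8 + 579) * 10 ^ m + 349
    & 729 * n + 1891 = (1000 * 7 + 489) * 10 ^ r].
Proof.
move=> j_def.
(* [2 + k + 3 = 13888890], written so that the period 243 of 10 modulo [3 ^ 7]
   applies. *)
have [u u_def] : exists u, u = 57 * 1000 + 155 by exists (57 * 1000 + 155).
have [k k_def] : exists k, k = 243 * u + 220 by exists (243 * u + 220).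
have Pk : 10 ^ (243 * u + 219) %% 2187 = 757.
  by apply: (@expn_mod_period 10 243 2187 u 219 757); clear; lia.
have k3 : 10 ^ (k + 3) = 10 ^ 4 * 10 ^ (243 * u + 219).
  by rewrite -expnD; congr (_ ^ _); rewrite k_def; lia.
move: (10 ^ (243 * u + 219)) Pk k3 => P Pk k3.
(* The equation for [m], divided by 8.  As 31 * 1250 is even, it determines
   [3 + m] modulo 2 as well as modulo [3 ^ 6]. *)
have [m m_def] : exists m, 3 * (3 + m) = 31 * 1250 * P + 1.
  by exists ((31 * 1250 * P + 1) %/ 3 - 3); lia.
have [v m_mod] : exists v, m = 1458 * v + 566 by exists (m %/ 1458); lia.
(* The modulus is [7 * 3 ^ 8], for which 10 has order [1458 = 2 * 3 ^ 6]. *)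
have Pm : 10 ^ (1458 * v + 566) %% (567 * 81) = 4447.
  by apply: (@expn_mod_period 10 1458 (567 * 81) v 566 4447); clear; lia.
rewrite -m_mod in Pm.
have [r r_def] : exists r, 567 * (3 + r) = (1000 * 8 + 579) * 10 ^ m + 349.
  exists (((1000 * 8 + 579) * 10 ^ m + 349) %/ 567 - 3).
  by move: (10 ^ m) Pm; clear=> Y; lia.
have [w r_mod] : exists w, r = 81 * w + 53.
  by exists (r %/ 81); move: (10 ^ m) Pm r_def; clear=> Y; lia.
have Pr : 10 ^ (81 * w + 53) %% 729 = 559.
  by apply: (@expn_mod_period 10 81 729 w 53 559); clear; lia.
rewrite -r_mod in Pr.
have [n n_def] : exists n, 729 * n + 1891 = (1000 * 7 + 489) * 10 ^ r.
  exists (((1000 * 7 + 489) * 10 ^ r - 1891) %/ 729).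
  by move: (10 ^ r) Pr => Z; lia.
exists k, m, r, n; split=> //; last by rewrite k3; lia.
by rewrite k_def u_def j_def; split; lia.
Qed.

(** * The chain of shapes *)

Lemma elated_shape13 j k : 6 <= j -> 648 * (2 + k + 3) = 9 * 10 ^ (j + 3) + 720 ->
  elated_shape 12 8 (j + 3) 51 -> elated_shape 13 8 (2 + k + 3) 168.
Proof.
move=> j_ge n13E H12; set b := 9 * 10 ^ (j + 3) - 112.
have V_ge : 10 ^ 4 <= 10 ^ (j + 3) by rewrite leq_exp2l //; lia.
have /andP[gap1 gap2] := allP gaps_check 168 isT.
apply: (@elated_shapeS 12 8 (j + 3) 51 8 (2 + k + 3) 168 b
  H12 isT isT isT _ gap1 gap2).
- lia.
- lia.
- by rewrite expnS; lia.
- move=> t d t_shape d_bd; have -> : d = 9 by lia.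
  exact: (@shaped8_ndvd9 _ 51 _ isT t_shape).
- by move=> t t_shape t8 _; apply: shaped51_dvd8 t_shape t8.
Qed.

Lemma elated_shape14 k m : 7 <= k -> 24 * (3 + m) = 31 * 10 ^ (k + 3) + 8 ->
  elated_shape 13 8 (2 + k + 3) 168 -> elated_shape 14 8 (3 + m) 105.
Proof.
move=> k_ge n14E H13; set b := 837 * 10 ^ (k + 3) - 112.
have X_ge : 10 ^ 4 <= 10 ^ (k + 3) by rewrite leq_exp2l //; lia.
have X_def : 10 ^ (2 + k + 3) = 100 * 10 ^ (k + 3) by rewrite -addnA expnD.
have /andP[gap1 gap2] := allP gaps_check 105 isT.
apply: (@elated_shapeS 13 8 (2 + k + 3) 168 8 (3 + m) 105 b
  H13 isT isT isT _ gap1 gap2).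
- lia.
- by rewrite X_def; lia.
- by rewrite expnS X_def; lia.
- move=> t d t_shape d_bd; have -> : d = 9 by lia.
  exact: (@shaped8_ndvd9 _ 168 _ isT t_shape).
- by move=> t t_shape t8 t_le; apply: (shaped168_dvd8 k_ge t_shape t8); lia.
Qed.

(** The target [b] is the least number of the shape of height 14, and the next one
    lies far above the values of [E2] at numbers with leading digit 7 and
    [3 + r] further digits. *)
Lemma elated_shape15 m r : 7 <= m ->
    567 * (3 + r) = (1000 * 8 + 579) * 10 ^ m + 349 ->
  elated_shape 14 8 (3 + m) 105 -> elated_shape 15 7 (3 + r) 99.
Proof.
move=> m_ge n15E H14; set b := (1000 * 8 + 579) * 10 ^ m - 1.
have Y_ge : 10 ^ 4 <= 10 ^ m by rewrite leq_exp2l //; lia.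
have Y_def : 10 ^ (3 + m) = 1000 * 10 ^ m by rewrite expnD.
have /andP[gap1 gap2] := allP gaps_check 99 isT.
apply: (@elated_shapeS 14 8 (3 + m) 105 7 (3 + r) 99 b
  H14 isT isT isT _ gap1 gap2).
- lia.
- by rewrite Y_def; lia.
- by rewrite expnS Y_def; lia.
- move=> t d t_shape d_bd; have [->|->] : d = 8 \/ d = 9 by lia.
    by apply: (@shaped105_ndvd8 m); rewrite addnC.
  exact: (@shaped8_ndvd9 _ 105 _ isT t_shape).
- move=> t t_shape _ t_le.
  by have [_] := shaped105_least m_ge t_shape; apply; lia.
Qed.

Lemma elated_shape16 r n : 7 <= r ->
    729 * n + 1891 = (1000 * 7 + 489) * 10 ^ r ->
  elated_shape 15 7 (3 + r) 99 -> elated_shape 16 9 (3 + n) 114.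
Proof.
move=> r_ge n16E H15; set b := (1000 * 7 + 489) * 10 ^ r - 1.
have Z_ge : 10 ^ 4 <= 10 ^ r by rewrite leq_exp2l //; lia.
have Z_def : 10 ^ (3 + r) = 1000 * 10 ^ r by rewrite expnD.
have /andP[gap1 gap2] := allP gaps_check 114 isT.
apply: (@elated_shapeS 15 7 (3 + r) 99 9 (3 + n) 114 b
  H15 isT isT isT _ gap1 gap2).
- lia.
- by rewrite Z_def; lia.
- by rewrite expnS Z_def; lia.
- by move=> t d _; lia.
- move=> t t_shape _ t_le.
  by have [_] := shaped99_least r_ge t_shape; apply; lia.
Qed.

Lemma epsilon_eq k b : elated_of_height k b ->
  (forall a, elated_of_height k a -> a <= b -> b <= a) -> epsilon k = b.
Proof.
move=> Hb min_b; rewrite /epsilon; case: ex_minnP => a Ha /(_ b Hb) le_ab.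
by apply/eqP; rewrite eqn_leq le_ab min_b.
Qed.

Theorem theorem23 :
  exists n16 : nat,
    (n16%:R = ((epsilon 15)%:R / 9 - 9 ^+ 2 - 129) / 9 ^+ 2 :> rat)%R /\
    epsilon 16 = 9189 * 10 ^ n16 - 1.
Proof.
have [j j_def] : exists j, j = 6 by exists 6.
have [k [m [r [n [[k_ge n13E] n14E n15E n16E]]]]] := lengths j_def.
have H12 : elated_shape 12 8 (j + 3) 51 by rewrite j_def; apply: elated_shape12.
have j_ge : 6 <= j by rewrite j_def.
have V_ge : 10 ^ 4 <= 10 ^ (j + 3) by rewrite leq_exp2l //; lia.
have n12 : j + 3 = 9 by rewrite j_def.
clear j_def.
have X_ge : 10 ^ 4 <= 10 ^ (k + 3) by rewrite leq_exp2l //; lia.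
have m_ge : 7 <= m by lia.
have Y_ge : 10 ^ 4 <= 10 ^ m by rewrite leq_exp2l; lia.
have r_ge : 7 <= r by lia.
have Z_ge : 10 ^ 4 <= 10 ^ r by rewrite leq_exp2l; lia.
have n_ge : 7 <= n by lia.
have W_ge : 10 ^ 4 <= 10 ^ n by rewrite leq_exp2l; lia.
have H15 := elated_shape15 m_ge n15E
  (elated_shape14 k_ge n14E (elated_shape13 j_ge n13E H12)).
have H16 := elated_shape16 r_ge n16E H15.
have h11 : elated_of_height 11 (8 * 742) by rewrite height5936.
have h12 : elated_of_height 12 (9 * 10 ^ (j + 3) - 112).
  by apply: elated_of_shaped (shaped51 j) _ _ h11; lia.
have h13 : elated_of_height 13 (837 * 10 ^ (k + 3) - 112).
  by apply: elated_of_shaped (shaped168 k) _ _ h12; lia.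
have h14 : elated_of_height 14 ((1000 * 8 + 579) * 10 ^ m - 1).
  have s14 : shaped 8 (3 + m) 105 ((1000 * 8 + 579) * 10 ^ m - 1).
    exact: (@shaped_witness 8 m 578 isT).
  by apply: elated_of_shaped s14 _ _ h13; lia.
have h15 : elated_of_height 15 ((1000 * 7 + 489) * 10 ^ r - 1).
  have s15 : shaped 7 (3 + r) 99 ((1000 * 7 + 489) * 10 ^ r - 1).
    exact: (@shaped_witness 7 r 488 isT).
  by apply: elated_of_shaped s15 _ _ h14; lia.
have h16 : elated_of_height 16 ((1000 * 9 + 189) * 10 ^ n - 1).
  have s16 : shaped 9 (3 + n) 114 ((1000 * 9 + 189) * 10 ^ n - 1).
    exact: (@shaped_witness 9 n 188 isT).
  by apply: elated_of_shaped s16 _ _ h15; lia.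
have e15 : epsilon 15 = (1000 * 7 + 489) * 10 ^ r - 1.
  apply: epsilon_eq h15 _ => a Ha a_le.
  have a_shape : shaped 7 (3 + r) 99 a.
    apply: H15 Ha _; rewrite expnS expnD.
    by move: (10 ^ r) Z_ge a_le; clear=> Z; lia.
  by have [] := shaped99_least r_ge a_shape.
have e16 : epsilon 16 = (1000 * 9 + 189) * 10 ^ n - 1.
  apply: epsilon_eq h16 _ => a Ha a_le.
  have a_shape : shaped 9 (3 + n) 114 a.
    apply: H16 Ha _; rewrite expnS expnD.
    by move: (10 ^ n) W_ge a_le; clear=> W; lia.
  by have [] := shaped114_least n_ge a_shape.
exists n; split.
  have -> : epsilon 15 = 9 * (81 * n + 210).
    by rewrite e15; move: (10 ^ r) Z_ge n16E; clear=> Z; lia.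
  by rewrite GRing.natrM GRing.natrD GRing.natrM; field.
by rewrite e16.
Qed.
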